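(* We have $\mathcal{D}' \cap [1,\sqrt{3}] = \mathcal{D}_0 \cap [1,\sqrt{3}] = \mathcal{D}\cap[1,\sqrt{3}]$.
   Context: Alphabets are arbitrary sets (finite or infinite); infinite words are right-infinite. The empty word counts as a palindrome and as a prefix of every word. For an infinite word $w$ with infinitely many palindromic prefixes, let $(n_i)_{i\ge1}$ be the increasing sequence of the lengths of all its palindromic prefixes ($n_1=0$), and $\delta(w)=\limsup n_{i+1}/n_i$; if $w$ has finitely many palindromic prefixes, $\delta(w)=\infty$. $w$ has abundant palindromic prefixes if it has infinitely many palindromic prefixes and $n_{i+1}\le 2n_i+1$ for all $i\ge 1$. $\mathcal{D}$ is the set of all $\delta(w)$ over all infinite words $w$ on arbitrary alphabets; $\mathcal{D}_0$ is the set of $\delta(w)$ over words with abundant palindromic prefixes. Characteristic Sturmian words: given positive integers $s_1,s_2,\dots$ and two distinct letters $a,b$, define $\sigma_0=a$, $\sigma_1=a^{s_1-1}b$, $\sigma_n=\sigma_{n-1}^{s_n}\sigma_{n-2}$ for $n\ge2$; each $\sigma_n$ ($n\ge1$) is a prefix of $\sigma_{n+1}$, and the limit word $c_\alpha$ is the characteristic Sturmian word of slope $\alpha=[0;s_1,s_2,\dots]$. $\mathcal{D}'$ is the set of values $\delta(w)$ where $w$ is either a periodic word with a palindromic period (i.e. $w=uuu\cdots$ with $u$ a nonempty palindrome) or a characteristic Sturmian word. *)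

(* Defs.v *)
From mathcomp Require Import all_boot all_order all_algebra.
From mathcomp Require Import all_classical all_reals all_analysis.
Set Implicit Arguments. Unset Strict Implicit. Unset Printing Implicit Defensive.
Import Order.TTheory GRing.Theory Num.Theory.
Local Open Scope classical_set_scope.
Local Open Scope ring_scope.

Definition pal_prefix (A : Type) (w : nat -> A) (n : nat) : Prop :=
  forall k, (k < n)%N -> w k = w (n.-1 - k)%N.

Definition inf_pal_prefixes (A : Type) (w : nat -> A) : Prop :=
  forall m, exists n, (m <= n)%N /\ pal_prefix w n.

(* ns is the increasing enumeration of the lengths of all palindromic prefixes
   (0-indexed: ns 0 = n_1 = 0, ns i = n_{i+1}). *)
Definition pal_enum (A : Type) (w : nat -> A) (ns : nat -> nat) : Prop :=
  (forall i, (ns i < ns i.+1)%N) /\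
  (forall n, pal_prefix w n <-> exists i, ns i = n).

Definition delta_val (R : realType) (A : Type) (w : nat -> A) (d : \bar R) : Prop :=
  (~ inf_pal_prefixes w /\ d = +oo%E) \/
  (inf_pal_prefixes w /\
   exists ns, pal_enum w ns /\
     d = limn_esup (fun i => ((ns i.+1)%:R / (ns i)%:R : R)%:E)).

Definition abundant (A : Type) (w : nat -> A) : Prop :=
  inf_pal_prefixes w /\
  exists ns, pal_enum w ns /\ forall i, (ns i.+1 <= (ns i).*2.+1)%N.

Fixpoint sturm_sigma (A : Type) (a b : A) (s : nat -> nat) (n : nat) : seq A * seq A :=
  (* returns (sigma_n, sigma_{n+1}) *)
  match n with
  | 0 => ([:: a], nseq (s 1%N).-1 a ++ [:: b])
  | m.+1 => let: (p, q) := sturm_sigma a b s m in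
            (q, flatten (nseq (s m.+2) q) ++ p)
  end.

Definition sigma (A : Type) (a b : A) (s : nat -> nat) (n : nat) : seq A :=
  (sturm_sigma a b s n).1.

(* w is the characteristic Sturmian word c_alpha, alpha = [0; s_1, s_2, ...]:
   every sigma_n (n >= 1) is a prefix of w. *)
Definition char_sturmian (A : Type) (w : nat -> A) : Prop :=
  exists (a b : A) (s : nat -> nat), a <> b /\ (forall i, (0 < i)%N -> (0 < s i)%N) /\
    forall n k, (1 <= n)%N -> (k < size (sigma a b s n))%N ->
      w k = nth a (sigma a b s n) k.

Definition periodic_pal (A : Type) (w : nat -> A) : Prop :=
  exists u : seq A, u <> [::] /\ rev u = u /\
    forall k, w k = nth (w 0%N) u (k %% size u).

Definition DsetAll (R : realType) : set (\bar R) :=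
  [set d | exists (A : Type) (w : nat -> A), delta_val w d].

Definition Dset0 (R : realType) : set (\bar R) :=
  [set d | exists (A : Type) (w : nat -> A), abundant w /\ delta_val w d].

Definition DsetPrime (R : realType) : set (\bar R) :=
  [set d | exists (A : Type) (w : nat -> A),
     (periodic_pal w \/ char_sturmian w) /\ delta_val w d].

Definition interval_1_sqrt3 (R : realType) : set (\bar R) :=
  [set d | (1%E <= d)%E /\ (d <= (Num.sqrt (3 : R))%:E)%E].

Arguments DsetAll R : clear implicits.
Arguments Dset0 R : clear implicits.
Arguments DsetPrime R : clear implicits.
Arguments interval_1_sqrt3 R : clear implicits.

(* Main.v *)
Require Import Defs.
From mathcomp Require Import all_boot all_order all_algebra.
From mathcomp Require Import all_classical all_reals all_analysis.
From mathcomp Require Import zify ring lra.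
Set Implicit Arguments. Unset Strict Implicit. Unset Printing Implicit Defensive.
Import Order.TTheory GRing.Theory Num.Theory.

(** Let [n_i] be the lengths of the palindromic prefixes and [r_i = n_{i+1} - n_i],
    the least period of the prefix of length [n_{i+1}].  If eventually
    [n_{i+1} <= sqrt 3 * n_i], then [n_i - r_i] is some [n_j] with [j < i], and
    whenever the gap jumps ([r_{i-1} < r_i]) a Fine-Wilf type argument gives
    [n_i < r_i + r_{i-1}].  Combined with the growth bound, this forces [j] to be
    the index just before the preceding jump.  Hence [n_i = r_i + a_i + C] with a
    constant [C], where [(r, a)] evolves by [(r, a) -> (r, r + a)] inside a block
    and by [(r, a) -> (r + a, r)] at a jump: exactly the evolution of a
    characteristic Sturmian word.  For two words with the same jumps the
    determinant [r a' - r' a] is constant up to sign, so their ratios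
    [n_{i+1} / n_i] have the same limit superior; if the jumps stop, the limit
    is that of a constant word.  The boundary value [sqrt 3] is attained by the
    slope with partial quotients 2, 1, 2, 1, ... *)

(** * Palindromic prefixes and periods *)

Definition prefix_period (A : Type) (w : nat -> A) (n p : nat) : Prop :=
  forall k, k + p < n -> w (k + p) = w k.

(** Composing the reflections of the two prefixes gives the translation by [n - m]. *)
Lemma pal_prefix_period (A : Type) (w : nat -> A) (m n : nat) :
  m <= n -> pal_prefix w m -> pal_prefix w n -> prefix_period w n (n - m).
Proof.
move=> le_mn pm pn k lt_k.
rewrite (pm k); last by lia.
rewrite (pn (k + (n - m))) //; congr (w _); lia.
Qed.

Lemma period_pal_prefix (A : Type) (w : nat -> A) (n p : nat) :
  pal_prefix w n -> prefix_period w n p -> pal_prefix w (n - p).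
Proof.
move=> pn per k lt_k; rewrite -(per k); last by lia.
rewrite (pn (k + p)); last by lia.
congr (w _); lia.
Qed.

Lemma pal_prefix_reflect (A : Type) (w : nat -> A) (m n : nat) :
  m <= n -> pal_prefix w m -> pal_prefix w n -> pal_prefix w (m - (n - m)).
Proof.
move=> le_mn pm pn; apply: period_pal_prefix => // k lt_k.
by apply: (pal_prefix_period le_mn pm pn); lia.
Qed.

Lemma pal_enum_pal (A : Type) (w : nat -> A) ns i :
  pal_enum w ns -> pal_prefix w (ns i).
Proof. by case=> _ pals; apply/pals; exists i. Qed.

Lemma increasing_ltn (ns : nat -> nat) :
  (forall i, ns i < ns i.+1) -> forall i j, (ns i < ns j) = (i < j).
Proof.
move=> lt_ns.
have lt_homo i j : i < j -> ns i < ns j.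
  elim: j => // j IHj; rewrite ltnS leq_eqVlt => /predU1P[-> //|/IHj lt_ij].
  exact: ltn_trans lt_ij (lt_ns j).
move=> i j; case: (ltngtP i j) => [/lt_homo -> //|/lt_homo lt_ji|->].
  by apply/negbTE; rewrite -leqNgt ltnW.
by rewrite ltnn.
Qed.

(** * Inequalities at the threshold [q * q = 3] *)

Local Open Scope ring_scope.

Lemma sqrt3_bounds (F : realFieldType) (q : F) :
  0 < q -> q * q = 3 -> 5 / 3 < q /\ q < 2.
Proof. by move=> q_gt0 qq; split; nra. Qed.

(** Here [r'] and [r] are the gaps before and after a jump at length [N]; the next jump, at length
    [n], reflects to [nj]. The hypotheses give [(2 - q) * r < (q - 1) * r'] and
    [(3 - q) * r' < (2 * q - 3) * r], which chain to a contradiction exactly because [q * q = 3]. *)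
Lemma long_block_contra (F : realFieldType) (q N r r' nj n : F) :
  0 < q -> q * q = 3 -> 0 < r' -> N < r + r' -> N + r <= q * N ->
  N + r <= n -> 2 * n - nj <= q * n -> nj + 2 * r' <= N -> False.
Proof.
move=> q_gt0 qq r'_gt0 ltN leN len leq_n lej.
have [gt_q lt_q] := sqrt3_bounds q_gt0 qq.
have h1 : (2 - q) * (N + r) <= (2 - q) * n by rewrite ler_pM2l //; lra.
have h2 : (q - 1) * N < (q - 1) * (r + r') by rewrite ltr_pM2l //; lra.
have h3 : (2 * q - 3) * ((2 - q) * r) < (2 * q - 3) * ((q - 1) * r').
  rewrite ltr_pM2l; lra.
have h4 : (2 - q) * ((3 - q) * r') < (2 - q) * ((2 * q - 3) * r).
  rewrite ltr_pM2l; lra.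
have E : (2 - q) * ((3 - q) * r') - (2 * q - 3) * ((q - 1) * r') =
  (3 - q * q) * r' by ring.
rewrite qq subrr mul0r in E.
lra.
Qed.

(** The same scheme when the gap [r'] occurs only once, between [r''] and [r]. The two inequalities
    are now [(2 - q) * r' < (q - 1) * r''] and [(4 - 2 * q) * r'' < (3 * q - 5) * r']. *)
Lemma short_block_contra (F : realFieldType) (q M r r' r'' nj n : F) :
  0 < q -> q * q = 3 -> 0 < r'' -> M < r' + r'' -> M + r' <= q * M ->
  r' + r'' <= r -> M + r' + r <= n -> 2 * n - nj <= q * n ->
  nj + r'' <= M -> False.
Proof.
move=> q_gt0 qq r''_gt0 ltM leM ler len leq_n lej.
have [gt_q lt_q] := sqrt3_bounds q_gt0 qq.
have h1 : (2 - q) * (M + 2 * r' + r'') <= (2 - q) * n.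
  by rewrite ler_pM2l //; lra.
have h2 : (q - 1) * M < (q - 1) * (r' + r'') by rewrite ltr_pM2l //; lra.
have h3 : (3 * q - 5) * ((2 - q) * r') < (3 * q - 5) * ((q - 1) * r'').
  rewrite ltr_pM2l; lra.
have h4 : (2 - q) * ((4 - 2 * q) * r'') < (2 - q) * ((3 * q - 5) * r').
  rewrite ltr_pM2l; lra.
have E : (2 - q) * ((4 - 2 * q) * r'') - (3 * q - 5) * ((q - 1) * r'') =
  (3 - q * q) * r'' by ring.
rewrite qq subrr mul0r in E.
lra.
Qed.

Local Close Scope ring_scope.

(** * Palindromic prefixes with slowly growing lengths *)

Definition prefix_gap (ns : nat -> nat) (i : nat) : nat := ns i.+1 - ns i.

Section SlowGrowth.

Variables (A : Type) (w : nat -> A) (ns : nat -> nat).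
Hypothesis enum_ns : pal_enum w ns.

Local Notation gap := (prefix_gap ns).

Let ns_ltn i j : (ns i < ns j) = (i < j).
Proof. by apply: increasing_ltn; case: enum_ns. Qed.

Let ns_leq i j : (ns i <= ns j) = (i <= j).
Proof. by rewrite leqNgt ns_ltn -leqNgt. Qed.

Let nsS i : ns i.+1 = ns i + gap i.
Proof. by rewrite /prefix_gap subnKC // ltnW // ns_ltn. Qed.

Let gap_gt0 i : 0 < gap i.
Proof. by rewrite subn_gt0 ns_ltn. Qed.

Lemma reflected_index i : gap i <= ns i ->
  exists j, j < i /\ ns j + gap i = ns i.
Proof.
move=> le_g.
have pal : pal_prefix w (ns i - gap i).
  apply: pal_prefix_reflect; try exact: pal_enum_pal enum_ns.
  by rewrite ltnW // ns_ltn.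
case: enum_ns => _ /(_ (ns i - gap i)) [] /(_ pal) [j Ej] _.
exists j; rewrite -ns_ltn Ej; have := gap_gt0 i; lia.
Qed.

Lemma gap_nondecreasing i : gap i.+1 <= ns i.+1 -> gap i <= gap i.+1.
Proof.
move=> /reflected_index [j [lt_ji Ej]].
have : ns j <= ns i by rewrite ns_leq.
rewrite nsS in Ej; lia.
Qed.

(* If both gaps fitted as periods inside the prefix of length [ns i.+1], the
   shorter one would propagate along the longer one and produce a palindromic
   prefix strictly between [ns i.+1] and [ns i.+2]. *)
Lemma gap_jump_bound i : gap i < gap i.+1 -> ns i.+1 < gap i.+1 + gap i.
Proof.
move=> lt_g; rewrite ltnNge; apply/negP => le_n.
have pal j : pal_prefix w (ns j) by exact: pal_enum_pal.
have per1 : prefix_period w (ns i.+1) (gap i).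
  by apply: pal_prefix_period => //; rewrite ns_leq.
have per2 : prefix_period w (ns i.+2) (gap i.+1).
  by apply: pal_prefix_period => //; rewrite ns_leq.
have per : prefix_period w (ns i.+2) (gap i).
  (* Below [gap i.+1] the shorter prefix supplies the period; beyond it, shift back by
     [gap i.+1]. *)
  elim/ltn_ind => k IHk lt_k.
  have [lt_kg|le_gk] := ltnP k (gap i.+1); first by apply: per1; lia.
  have := IHk (k - gap i.+1); have := per2 (k - gap i.+1).
  have := per2 (k + gap i - gap i.+1); have := gap_gt0 i.+1.
  rewrite !subnK //; last by lia.
  move=> gt0 -> //; move=> -> //; try lia.
  rewrite (_ : _ - _ + gap i = k + gap i - gap i.+1); last by lia.
  by apply; lia.
have [_ /(_ (ns i.+2 - gap i)) [/(_ (period_pal_prefix (pal _) per)) [j Ej] _]]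
  := enum_ns.
have gt0 := gap_gt0 i; have E := nsS i.+1.
have : i.+1 < j by rewrite -ns_ltn Ej; lia.
have : j < i.+2 by rewrite -ns_ltn Ej; lia.
lia.
Qed.

Variables (F : realFieldType) (q : F) (i0 : nat).
Hypotheses (q_gt0 : (0 < q)%R) (qq : (q * q = 3)%R).
Hypothesis slow :
  forall i, i0 <= i -> ((ns i.+1)%:R <= q * (ns i)%:R :> F)%R.

Let gap_le i : i0 <= i -> gap i <= ns i.
Proof.
move=> /slow; rewrite nsS -(@ler_nat F) natrD.
have [_ lt_q] := sqrt3_bounds q_gt0 qq.
have : (0 <= (ns i)%:R :> F)%R by [].
move=> n_ge0 len; have : ((2 - q) * (ns i)%:R >= 0 :> F)%R.
  by rewrite mulr_ge0 //; lra.
lra.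
Qed.

(** Reflection at [m.+1] yields some [ns j]. The jump bound at [m] excludes [j > l], and the growth
    bound excludes [j < l]. *)
Lemma consecutive_jumps l m : i0 < l -> l < m ->
  gap l < gap l.+1 -> (forall k, l < k <= m -> gap k = gap l.+1) ->
  gap m < gap m.+1 -> ns l + gap m.+1 = ns m.+1.
Proof.
move=> lt_i0 lt_lm jump_l const jump_m.
have [|j [lt_j Ej]] := @reflected_index m.+1; first by apply: gap_le; lia.
have gap_m : gap m = gap l.+1 by apply: const; rewrite lt_lm leqnn.
have bound_m := gap_jump_bound jump_m.
have le_jl : j <= l.
  rewrite leqNgt -ns_ltn; apply/negP => lt_lj.
  have : ns l.+1 <= ns j by rewrite ns_leq -ns_ltn.
  have := @gap_le l.+1; lia.
have [<- //|lt_jl] : j = l \/ j < l by lia.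
exfalso; case: l => [|l] in lt_i0 lt_lm jump_l const gap_m bound_m le_jl lt_jl *.
  by [].
have le_jl' : ns j <= ns l by rewrite ns_leq.
have bound_l := gap_jump_bound jump_l.
have le_n : ns l.+3 <= ns m.+1 by rewrite ns_leq.
have slow_m : ((ns m.+2)%:R <= q * (ns m.+1)%:R :> F)%R by apply: slow; lia.
have le_gap : gap l <= gap l.+1 by apply/gap_nondecreasing/gap_le; lia.
have natF (a b : nat) : a <= b -> (a%:R <= b%:R :> F)%R by rewrite ler_nat.
have natFlt (a b : nat) : a < b -> (a%:R < b%:R :> F)%R by rewrite ltr_nat.
have twice : (2 * (ns m.+1)%:R - (ns j)%:R <= q * (ns m.+1)%:R :> F)%R.
  apply: le_trans slow_m; rewrite (nsS m.+1) natrD.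
  have : ((ns j)%:R + (gap m.+1)%:R = (ns m.+1)%:R :> F)%R by rewrite -natrD Ej.
  lra.
(* The block ending at the earlier jump has either at least two gaps or only one. *)
have [eq_gap|lt_gap] : gap l = gap l.+1 \/ gap l < gap l.+1 by lia.
  apply: (@long_block_contra F q (ns l.+2)%:R (gap l.+2)%:R (gap l.+1)%:R
            (ns j)%:R (ns m.+1)%:R) => //.
  - by rewrite ltr0n.
  - by rewrite -natrD ltr_nat.
  - by rewrite -natrD -nsS; apply: slow; lia.
  - by rewrite -natrD -nsS; apply: natF.
  - by rewrite -natrM -natrD; apply: natF; rewrite !nsS; lia.
(* The reflection at [l.+2] cannot be [l.+1], which forces [gap l.+2 >= gap l.+1 + gap l]. *)
have [|j' [lt_j' Ej']] := @reflected_index l.+2; first by apply: gap_le; lia.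
have ne_j' : j' <> l.+1 by move=> E; rewrite E (nsS l.+1) in Ej'; lia.
have le_j' : ns j' <= ns l by rewrite ns_leq; lia.
apply: (@short_block_contra F q (ns l.+1)%:R (gap l.+2)%:R (gap l.+1)%:R
          (gap l)%:R (ns j)%:R (ns m.+1)%:R) => //.
- by rewrite ltr0n.
- by rewrite -natrD ltr_nat; apply: gap_jump_bound.
- by rewrite -natrD -nsS; apply: slow; lia.
- by rewrite -natrD; apply: natF; rewrite !nsS in Ej'; lia.
- by rewrite -!natrD -!nsS; apply: natF.
- by rewrite -natrD; apply: natF; rewrite !nsS; lia.
Qed.

(** By [consecutive_jumps], [gap m.+1 + gap m - ns m.+1] has the same value at successive jumps; [C]
    is its value at a chosen jump [l0]. *)
Lemma jump_defect_constant : exists C i1, forall m, i1 <= m ->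
  gap m <= gap m.+1 /\
  (gap m < gap m.+1 -> ns m.+1 + C = gap m.+1 + gap m).
Proof.
have mono m : i0 <= m -> gap m <= gap m.+1.
  by move=> le_m; apply/gap_nondecreasing/gap_le; lia.
have [[l0 [lt_l0 jump0]]|no_jump] :=
    pselect (exists l, i0 < l /\ gap l < gap l.+1); last first.
  (* With no jump beyond [i0] the second clause is vacuous. *)
  exists 0, i0.+1 => m lt_m; split; first by apply: mono; lia.
  by move=> jump; case: no_jump; exists m.
pose C := gap l0.+1 + gap l0 - ns l0.+1.
have C0 : ns l0.+1 + C = gap l0.+1 + gap l0.
  by rewrite subnKC // ltnW //; apply: gap_jump_bound.
have defect l m : l0 <= l -> l < m -> gap l < gap l.+1 ->
    ns l.+1 + C = gap l.+1 + gap l ->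
    (forall k, l < k <= m -> gap k = gap l.+1) -> gap m < gap m.+1 ->
    ns m.+1 + C = gap m.+1 + gap m.
  move=> le_l lt_lm jump_l Cl const jump_m.
  have := consecutive_jumps (leq_trans lt_l0 le_l) lt_lm jump_l const jump_m.
  have -> : gap m = gap l.+1 by apply: const; rewrite lt_lm leqnn.
  by move: Cl; rewrite (nsS l); lia.
have last_jump m : l0 < m -> exists l, [/\ l0 <= l, l < m, gap l < gap l.+1,
    ns l.+1 + C = gap l.+1 + gap l &
    forall k, l < k <= m -> gap k = gap l.+1].
  elim: m => // m IHm; rewrite ltnS leq_eqVlt => /predU1P[<-|lt_m].
    by exists l0; split=> // k lt_k; congr prefix_gap; lia.
  have [l [le_l lt_lm jump_l Cl const]] := IHm lt_m.
  have [eq_gap|jump_m] : gap m.+1 = gap m \/ gap m < gap m.+1.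
    by have := @mono m; lia.
    exists l; split=> // [|k lt_k]; first by lia.
    have [le_k|->] : k <= m \/ k = m.+1 by lia.
      by apply: const; lia.
    by rewrite eq_gap; apply: const; lia.
  exists m; split=> //; [by lia | exact: (defect l) |].
  by move=> k lt_k; congr prefix_gap; lia.
exists C, l0 => m le_m; split; first by apply: mono; lia.
have [<- //|lt_m] : l0 = m \/ l0 < m by lia.
by have [l [? ? ? ? ?]] := last_jump m lt_m; apply: (defect l).
Qed.

End SlowGrowth.

(** * The binary word directed by a sequence of jumps *)

Section DirectedWord.

Variable f : nat -> bool.

(* If the current block of equal gaps has period word [u], the previous one
   has period word [v] and the current one has lasted [m] steps, then the state
   is [(u, u ^ m v)]; [f i.+1] tells whether a new block starts. *)
Fixpoint dstate (i : nat) : seq bool * seq bool :=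
  if i is j.+1 then
    let: (u, v) := dstate j in if f i then (u ++ v, u) else (u, u ++ v)
  else ([:: true], [:: false]).

Fixpoint dpal (i : nat) : seq bool :=
  if i is j.+1 then (dstate j).1 ++ dpal j else [::].

(** The letter that follows [dpal i] in [dword], see [dword_size_dpal]. *)
Fixpoint dletter (i : nat) : bool :=
  if i is j.+1 then dletter j (+) f i else true.

(** [dpal k.+1] has length at least [k.+1], so the default [true] is never read. *)
Definition dword (k : nat) : bool := nth true (dpal k.+1) k.

(** Near-commutation of standard words: [u ++ v] and [v ++ u] differ only in their last two letters,
    and their common part is the central palindrome. *)
Lemma dpalP i : let: (u, v) := dstate i in let c := dpal i in
  [/\ u ++ v = c ++ [:: dletter i; ~~ dletter i],
      v ++ u = c ++ [:: ~~ dletter i; dletter i],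
      u ++ c = c ++ rev u, v ++ c = c ++ rev v & rev c = c].
Proof.
elim: i => [|i] //=; case: (dstate i) => u v /= [uv vu uc vc cc].
have uvc : (u ++ v) ++ u ++ dpal i = (u ++ dpal i) ++ rev (u ++ v).
  by rewrite -catA uc (catA v) vc rev_cat !catA uc.
have uuc : u ++ u ++ dpal i = (u ++ dpal i) ++ rev u by rewrite uc catA uc.
have cuc : rev (u ++ dpal i) = u ++ dpal i by rewrite rev_cat cc -uc.
by case: (f i.+1); rewrite ?addbT ?addbF ?negbK; split=> //;
  rewrite -?catA ?vu ?uv.
Qed.

Lemma dstate_size_gt0 i :
  0 < size (dstate i).1 /\ 0 < size (dstate i).2.
Proof.
elim: i => //= i; case: (dstate i) => u v /= [u0 v0].
by case: (f _); rewrite /= size_cat; lia.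
Qed.

Lemma size_dstate i : size (dstate i).1 + size (dstate i).2 = (size (dpal i)).+2.
Proof.
have := dpalP i; case: (dstate i) => u v [uv _ _ _ _].
by rewrite -size_cat uv size_cat addn2.
Qed.

Lemma size_dpalS i : size (dpal i.+1) = size (dpal i) + size (dstate i).1.
Proof. by rewrite /= size_cat addnC. Qed.

Lemma size_dpal_ltS i : size (dpal i) < size (dpal i.+1).
Proof. by have [] := dstate_size_gt0 i; rewrite size_dpalS; lia. Qed.

Lemma size_dpal_ltn i j : (size (dpal i) < size (dpal j)) = (i < j).
Proof. exact: (increasing_ltn size_dpal_ltS). Qed.

Lemma size_dpal_geq i : i <= size (dpal i).
Proof. by elim: i => // i IHi; have := size_dpal_ltS i; lia. Qed.

Lemma dpalS_cat i : dpal i.+1 = dpal i ++ rev (dstate i).1.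
Proof. by have := dpalP i; rewrite /=; case: (dstate i) => u v []. Qed.

Lemma nth_dpal i k : k < size (dpal i) -> nth true (dpal i) k = dword k.
Proof.
have step j n : k < size (dpal j) ->
    nth true (dpal (j + n)) k = nth true (dpal j) k /\ k < size (dpal (j + n)).
  move=> lt_k; elim: n => [|n [IHn lt_n]]; first by rewrite addn0.
  rewrite addnS; split; last exact: ltn_trans lt_n (size_dpal_ltS _).
  by rewrite dpalS_cat nth_cat lt_n.
move=> lt_k; have [<- _] := step i k.+1 lt_k; rewrite addnC.
by have [-> //] := step k.+1 i (size_dpal_geq k.+1).
Qed.

Lemma dpal_pal_prefix i : pal_prefix dword (size (dpal i)).
Proof.
move=> k lt_k; rewrite -(nth_dpal lt_k) -(@nth_dpal i); last by lia.
have := dpalP i; case: (dstate i) => u v [_ _ _ _ cc].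
rewrite -[in LHS]cc nth_rev //; congr nth; lia.
Qed.

Lemma dstate_prefix i k : k < size (dstate i).1 ->
  nth true (dstate i).1 k = dword k.
Proof.
move=> lt_k; rewrite -(@nth_dpal i.+1) ?size_dpalS ?ltn_addl //=.
by rewrite nth_cat lt_k.
Qed.

(** [v ++ u] ends in [dletter i], hence so does [u], and [dpal i.+1] continues [dpal i] with
    [rev u]. *)
Lemma dword_size_dpal i : dword (size (dpal i)) = dletter i.
Proof.
rewrite -(@nth_dpal i.+1) ?size_dpal_ltS // dpalS_cat.
have := dpalP i; have [] := dstate_size_gt0 i.
case: (dstate i) => u v /= + _ [_ vu _ _ _].
case: (lastP u) vu => // u' x; rewrite -rcons_cat.
rewrite -[[:: _; _]]/(rcons [:: _] _) -rcons_cat => /rcons_inj [_ ->] _.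
by rewrite rev_rcons nth_cat ltnn subnn.
Qed.

(** With [size_dstate], the equal-letter case makes the lengths of [dpal j] and [dpal i] differ by
    at least the size of [(dstate i).1]. A jump turns the unequal-letter case into the equal one. *)
Lemma dletter_bound i j : j < i ->
  if dletter j == dletter i then size (dpal j) + 2 <= size (dstate i).2
  else size (dpal j) + 2 <= size (dstate i).1.
Proof.
elim: i j => // i IHi j; rewrite ltnS leq_eqVlt => le_ji.
have := IHi j; have := size_dstate i.
have [->|lt_ji] : j = i \/ j < i by case/predU1P: le_ji; auto.
  move=> sz _ /=; case: (dstate i) sz => u v /= sz.
  case: (f i.+1); rewrite ?addbT ?addbF ?eqxx /=.
    by case: (dletter i); rewrite /= size_cat; lia.
  by rewrite size_cat; lia.
move=> sz /(_ lt_ji) /=; case: (dstate i) sz => u v /= sz.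
have lt_s : size (dpal j) < size (dpal i).
  by rewrite size_dpal_ltn.
case: (f i.+1); rewrite ?addbT ?addbF /=;
  by case: (dletter i); case: (dletter j); rewrite /= ?size_cat; lia.
Qed.

Lemma dword_pal_enum : pal_enum dword (fun i => size (dpal i)).
Proof.
split=> [|n]; first exact: size_dpal_ltS.
split=> [|[i <-]]; last exact: dpal_pal_prefix.
(* Strong induction, so that a reflected, shorter palindromic prefix is already some [dpal j]. *)
elim/ltn_ind: n => n IHn pal_n.
have ex_i : exists i, n < size (dpal i.+1).
  by exists n; exact: size_dpal_geq.
have [i lt_n min_i] := ex_minnP ex_i.
have le_n : size (dpal i) <= n.
  case: i lt_n min_i => // i _ min_i; rewrite leqNgt; apply/negP => lt_n.
  by have := min_i _ lt_n; rewrite ltnn.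
have [->|ne_n] := eqVneq n (size (dpal i)); first by exists i.
(* A further palindromic prefix would reflect to some [dpal j] followed by the
   same letter as [dpal i], with a period contradicting [dletter_bound]. *)
exfalso; have pal_i := @dpal_pal_prefix i.
have [u_gt0 v_gt0] := dstate_size_gt0 i; have sz := size_dstate i.
rewrite size_dpalS in lt_n.
set p := n - size (dpal i); have p_le : p <= size (dpal i) by lia.
have [||j Ej] := IHn (size (dpal i) - p); first by lia.
  exact: pal_prefix_reflect.
have lt_ji : j < i by rewrite -size_dpal_ltn Ej; lia.
have := dletter_bound lt_ji; rewrite -!dword_size_dpal.
have per := pal_prefix_period le_n pal_i pal_n.
have := per (size (dpal j)); rewrite {1 2}Ej -/p subnK // => -> //; last by lia.
by rewrite eqxx; lia.
Qed.

Lemma dword_inf_pal_prefixes : inf_pal_prefixes dword.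
Proof.
move=> m; exists (size (dpal m)).
by split; [exact: size_dpal_geq | exact: dpal_pal_prefix].
Qed.

Lemma dword_abundant : abundant dword.
Proof.
split; first exact: dword_inf_pal_prefixes.
exists (fun i => size (dpal i)); split; first exact: dword_pal_enum.
move=> i; rewrite size_dpalS; have [_] := dstate_size_gt0 i.
by have := size_dstate i; lia.
Qed.

Lemma dword_periodic : (forall i, f i = false) -> periodic_pal dword.
Proof.
move=> f0; exists [:: true]; split=> //; split=> // k.
have E i : (dstate i).1 = [:: true].
  by elim: i => //= i; case: (dstate i) => u v; rewrite f0.
have -> : dword k = true.
  rewrite /dword; have {1}-> : dpal k.+1 = nseq k.+1 true.
    by elim: k.+1 => //= i ->; rewrite E.
  by rewrite nth_nseq ltnS leqnn.
by rewrite modn1.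
Qed.

(** The Sturmian recursion: one block contributes the power in
    [sigma_n = sigma_{n-1}^{s_n} sigma_{n-2}]. *)
Lemma dstate_block m n : m < n -> f n ->
  (forall k, m < k < n -> f k = false) ->
  dstate n = (flatten (nseq (n - m) (dstate m).1) ++ (dstate m).2, (dstate m).1).
Proof.
move=> lt_mn fn f0; have inside k : m + k < n ->
    dstate (m + k) = ((dstate m).1, flatten (nseq k (dstate m).1) ++ (dstate m).2).
  elim: k => [|k IHk] lt_k; first by rewrite addn0 -surjective_pairing.
  rewrite addnS /= IHk; last by lia.
  by rewrite f0 ?catA //; lia.
have [k En] : exists k, n = (m + k).+1 by exists (n - m).-1; lia.
rewrite En in fn inside *; rewrite /= inside // fn catA subSn ?leq_addr //.
by rewrite addKn.
Qed.

Hypothesis f_inf : forall m, exists n, (m < n) && f n.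

Let next m := ex_minn (f_inf m).

Let nextP m : [/\ m < next m, f (next m) & forall k, m < k < next m -> f k = false].
Proof.
rewrite /next; case: ex_minnP => n /andP[lt_mn fn] min_n; split=> // k /andP[lt_k].
by apply: contraTF => fk; rewrite -leqNgt min_n ?lt_k.
Qed.

Let jump k := iter k next 0.

Lemma dword_char_sturmian : char_sturmian dword.
Proof.
(* Block lengths; the extra 1 at index 1 compensates the exponent [s_1 - 1] in [sigma_1]. *)
pose s i := (i == 1) + (jump i - jump i.-1).
have lt_jump i : jump i < jump i.+1 by rewrite /jump /=; case: (nextP (iter i next 0)).
exists true, false, s; split=> //; split=> [[//|i] _|].
  by rewrite /s addn_gt0 subn_gt0 lt_jump orbT.
have s1 : (s 1).-1 = next 0 by rewrite /s /jump subn0.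
have E k : sturm_sigma true false s k =
    ((dstate (jump k.+1)).2, (dstate (jump k.+1)).1).
  elim: k => [|k IHk].
    have -> : sturm_sigma true false s 0 =
        ([:: true], nseq (next 0) true ++ [:: false]) by rewrite -s1.
    have [lt0 f1 f0] := nextP 0; rewrite /jump /= (dstate_block lt0 f1 f0) /=.
    congr (_, _ ++ _); rewrite subn0.
    by elim: (next 0) => //= n ->.
  have [lt0 f1 f0] := nextP (jump k.+1).
  have -> : jump k.+2 = next (jump k.+1) by [].
  by rewrite (dstate_block lt0 f1 f0) /= IHk.
move=> [//|n] k _; rewrite /sigma.
have -> : (sturm_sigma true false s n.+1).1 = (sturm_sigma true false s n).2.
  by rewrite /=; case: sturm_sigma.
by rewrite E => lt_k; rewrite dstate_prefix.
Qed.

End DirectedWord.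

(** * Limits superior *)

Local Open Scope ring_scope.

Section Limsup.

Variable R : realType.

Lemma limn_esup_le_near (u : nat -> R) (x : R) (m : nat) :
  (forall i, (m <= i)%N -> u i <= x) -> (limn_esup (fun i => (u i)%:E) <= x%:E)%E.
Proof.
move=> le_u; rewrite /limn_esup limf_esupE; apply: ge_ereal_inf.
exists (ereal_sup ((fun i => (u i)%:E) @` [set i | (m <= i)%N])%classic).
  exists [set i | (m <= i)%N]%classic => //.
  by exists m => // i.
by apply: ge_ereal_sup => _ [i le_i <-]; rewrite lee_fin le_u.
Qed.

Lemma limn_esup_lt_near (u : nat -> R) (x : R) :
  (limn_esup (fun i => (u i)%:E) < x%:E)%E ->
  exists m, forall i, (m <= i)%N -> u i < x.
Proof.
rewrite /limn_esup limf_esupE => /ereal_inf_lt [_ [V [m _ mV] <-] lt_x].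
exists m => i le_i; rewrite -lte_fin; apply: le_lt_trans lt_x.
by apply: ereal_sup_ubound; exists i => //; apply: mV.
Qed.

Lemma limn_esup_ge_frequently (u : nat -> R) (x : R) :
  (forall m, exists i, (m <= i)%N /\ x <= u i) ->
  (x%:E <= limn_esup (fun i => (u i)%:E))%E.
Proof.
move=> freq; rewrite leNgt; apply/negP => /limn_esup_lt_near [m lt_u].
by have [i [le_i le_x]] := freq m; have := lt_u i le_i; rewrite ltNge le_x.
Qed.

Lemma limn_esup_le_close (u v : nat -> R) :
  (forall e : R, 0 < e -> exists m, forall i, (m <= i)%N -> `|u i - v i| <= e) ->
  (limn_esup (fun i => (u i)%:E) <= limn_esup (fun i => (v i)%:E))%E.
Proof.
move=> close; set U := limn_esup _; set V := limn_esup _.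
have le_UV x : (V < x%:E)%E -> (U <= x%:E)%E.
  move=> /limn_esup_lt_near [m lt_v]; apply/lee_addgt0Pr => e e_gt0.
  have [m' close_m'] := close e e_gt0.
  apply: (@limn_esup_le_near _ _ (maxn m m')) => i; rewrite geq_max => /andP[mi m'i].
  by have := lt_v i mi; have := close_m' i m'i; rewrite ler_norml; lra.
case: V le_UV => [y| |] le_UV; [|exact: leey|].
  apply/lee_addgt0Pr => e e_gt0; rewrite -EFinD; apply: le_UV.
  by rewrite lte_fin ltrDl.
(* Here [V] is [-oo], so [U] lies below every real. *)
case: U le_UV => [x| |] le_UV //.
  by have := le_UV (x - 1) (ltNyr _); rewrite lee_fin => ?; exfalso; lra.
by have := le_UV 0 (ltNyr _).
Qed.

Lemma limn_esup_close (u v : nat -> R) :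
  (forall e : R, 0 < e -> exists m, forall i, (m <= i)%N -> `|u i - v i| <= e) ->
  limn_esup (fun i => (u i)%:E) = limn_esup (fun i => (v i)%:E).
Proof.
move=> close; apply/eqP; rewrite eq_le !limn_esup_le_close // => e e_gt0.
by have [m close_m] := close e e_gt0; exists m => i le_i; rewrite distrC close_m.
Qed.

End Limsup.

(** * Ratios along a sequence of jumps *)

(* [r] is the current gap and [a] the length of the second component of
   [dstate]; the two moves are unimodular, which is what makes the limit of the
   ratios independent of the initial state. *)
Definition gap_moves (R : realType) (f : nat -> bool) (m : nat) (r a : nat -> R) :=
  forall i, (m <= i)%N ->
    if f i.+1 then r i.+1 = r i + a i /\ a i.+1 = r i
    else r i.+1 = r i /\ a i.+1 = r i + a i.

Definition unbounded (R : realType) (n : nat -> R) :=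
  forall B, exists m, forall i, (m <= i)%N -> B <= n i.

Section Ratios.

Variable R : realType.

Lemma gap_moves_det (f : nat -> bool) m (r a r' a' : nat -> R) :
  gap_moves f m r a -> gap_moves f m r' a' ->
  forall i, (m <= i)%N ->
    `|r i * a' i - r' i * a i| = `|r m * a' m - r' m * a m|.
Proof.
move=> mv mv' i le_i; rewrite -(subnKC le_i).
elim: (i - m)%N => [|k IHk]; first by rewrite addn0.
rewrite -IHk addnS; have := mv (m + k)%N; have := mv' (m + k)%N.
rewrite leq_addr; case: (f _) => /(_ isT)[-> ->] /(_ isT)[-> ->].
  by rewrite -normrN; congr `|_|; ring.
by congr `|_|; ring.
Qed.

Lemma gap_moves_limsup (f : nat -> bool) m (r a n r' a' n' : nat -> R) (C C' : R) :
  gap_moves f m r a -> gap_moves f m r' a' ->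
  (forall i, (m <= i)%N -> n i.+1 = n i + r i) ->
  (forall i, (m <= i)%N -> n' i.+1 = n' i + r' i) ->
  (forall i, (m <= i)%N -> n i = r i + a i + C) ->
  (forall i, (m <= i)%N -> n' i = r' i + a' i + C') ->
  (forall i, (m <= i)%N -> 0 <= r i <= 2 * n i) ->
  (forall i, (m <= i)%N -> 0 <= r' i <= 2 * n' i) ->
  unbounded n -> unbounded n' ->
  limn_esup (fun i => (n i.+1 / n i)%:E) = limn_esup (fun i => (n' i.+1 / n' i)%:E).
Proof.
move=> mv mv' nS n'S nE n'E rn rn' unb unb'.
apply: limn_esup_close => e e_gt0.
pose D := `|r m * a' m - r' m * a m|.
pose K := D + 2 * `|C| + 2 * `|C'|.
have D_ge0 : 0 <= D by apply: normr_ge0.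
have K_ge0 : 0 <= K by rewrite /K; have := normr_ge0 C; have := normr_ge0 C'; lra.
(* The threshold ensures both [n i >= 1], which absorbs [D], and [K <= e * n i]; likewise for
   [n']. *)
have [m1 le_n] := unb (1 + K / e); have [m2 le_n'] := unb' (1 + K / e).
exists (maxn m (maxn m1 m2)) => i; rewrite !geq_max => /and3P[mi m1i m2i].
have B_ge1 : 1 <= 1 + K / e by rewrite lerDl divr_ge0 // ltW.
have := le_n i m1i; have := le_n' i m2i => Bn' Bn.
have n_gt0 : 0 < n i by lra.
have n'_gt0 : 0 < n' i by lra.
(* The numerator is the constant-size determinant plus terms linear in the gaps, while the
   denominator is a product of two unbounded lengths. *)
have -> : n i.+1 / n i - n' i.+1 / n' i =
    (r i * a' i - r' i * a i + (r i * C' - r' i * C)) / (n i * n' i).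
  rewrite nS // n'S //.
  transitivity ((r i * n' i - r' i * n i) / (n i * n' i)).
    by field; rewrite !gt_eqF.
  by congr (_ / _); rewrite nE // n'E //; ring.
rewrite normrM normfV (gtr0_norm (mulr_gt0 n_gt0 n'_gt0)).
rewrite ler_pdivrMr ?mulr_gt0 //.
have /andP[r_ge0 le_r] := rn i mi; have /andP[r'_ge0 le_r'] := rn' i mi.
have K_le x : 1 + K / e <= x -> K <= e * x.
  by move=> le_x; rewrite mulrC -ler_pdivrMr //; lra.
apply: (@le_trans _ _ (D + (2 * n i * `|C'| + 2 * n' i * `|C|))).
  apply: (le_trans (ler_normD _ _)); rewrite (gap_moves_det mv mv') // lerD2l.
  apply: (le_trans (ler_normB _ _)); rewrite !normrM (ger0_norm r_ge0) (ger0_norm r'_ge0).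
  by apply: lerD; apply: ler_wpM2r.
have C_ge0 := normr_ge0 C; have C'_ge0 := normr_ge0 C'.
have [le_nn'|/ltW le_nn'] := leP (n i) (n' i).
  apply: (@le_trans _ _ (K * n' i)).
    rewrite /K; nra.
  by rewrite mulrA ler_pM2r // K_le.
apply: (@le_trans _ _ (K * n i)); first by rewrite /K; nra.
by rewrite (mulrC (n i)) mulrA ler_pM2r // K_le.
Qed.

Lemma unbounded_growth (n : nat -> R) (c : R) m : 0 < c ->
  (forall i, (m <= i)%N -> n i + c <= n i.+1) -> unbounded n.
Proof.
move=> c_gt0 grow B.
have lin k : n m + c * k%:R <= n (m + k)%N.
  elim: k => [|k IHk]; first by rewrite mulr0 addr0 addn0.
  rewrite addnS -natr1 mulrDr mulr1 addrA.
  by apply: le_trans (grow _ (leq_addr _ _)); rewrite lerD2r.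
have [k lt_k] : exists k : nat, (B - n m) / c < k%:R.
  exists (Num.bound `|(B - n m) / c|); apply: le_lt_trans (ler_norm _) _.
  exact/archi_boundP/normr_ge0.
exists (m + k)%N => i le_i; rewrite -(subnKC (leq_trans (leq_addr k m) le_i)).
apply: le_trans (lin _).
have : k%:R <= (i - m)%:R :> R by rewrite ler_nat; lia.
rewrite ltr_pdivrMr // in lt_k => le_k.
have : c * k%:R <= c * (i - m)%:R by rewrite ler_pM2l.
lra.
Qed.

End Ratios.

(** * Realizing limits superior by directed words *)

Section Realization.

Variable R : realType.

Lemma dstate_moves (f : nat -> bool) m :
  gap_moves f m (fun i => (size (dstate f i).1)%:R : R)
                (fun i => (size (dstate f i).2)%:R).
Proof.
move=> i _ /=; case: (dstate f i) => u v /=.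
by case: (f i.+1); rewrite /= size_cat natrD.
Qed.

Lemma dword_limsup (f : nat -> bool) m (r a n : nat -> R) (C : R) :
  gap_moves f m r a ->
  (forall i, (m <= i)%N -> n i.+1 = n i + r i) ->
  (forall i, (m <= i)%N -> n i = r i + a i + C) ->
  (forall i, (m <= i)%N -> 0 <= r i <= 2 * n i) ->
  unbounded n ->
  delta_val (dword f) (limn_esup (fun i => (n i.+1 / n i)%:E)).
Proof.
move=> mv nS nE rn unb; right; split; first exact: dword_inf_pal_prefixes.
exists (fun i => size (dpal f i)); split; first exact: dword_pal_enum.
have sub_m i : (maxn m 1 <= i)%N -> (m <= i)%N by rewrite geq_max => /andP[].
(* The constant [-2] comes from [size_dstate]. Index 0 is left out: [dpal 0] is empty, so the bound
   on its gap fails. *)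
apply: (@gap_moves_limsup R f (maxn m 1) r a n
  (fun i => (size (dstate f i).1)%:R) (fun i => (size (dstate f i).2)%:R)
  (fun i => (size (dpal f i))%:R) C (-2)) => //.
- by move=> i /sub_m; exact: mv.
- exact: dstate_moves.
- by move=> i /sub_m; exact: nS.
- by move=> i _; rewrite size_dpalS natrD.
- by move=> i /sub_m; exact: nE.
- by move=> i _; rewrite -natrD size_dstate -addn2 natrD addrK.
- by move=> i /sub_m; exact: rn.
- move=> i; rewrite geq_max ler0n -natrM ler_nat => /andP[_ i_gt0].
  have := size_dstate f i; have := size_dpal_geq f i.
  by have [] := dstate_size_gt0 f i; lia.
- apply: (@unbounded_growth R _ 1 0) => // i _.
  by rewrite natr1 ler_nat size_dpal_ltS.
Qed.

(** Infinitely many jumps give a characteristic Sturmian word, finitely many a constant word. *)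
Lemma gap_moves_realized (f : nat -> bool) m (r a n : nat -> R) (C : R) :
  gap_moves f m r a ->
  (forall i, (m <= i)%N -> n i.+1 = n i + r i) ->
  (forall i, (m <= i)%N -> n i = r i + a i + C) ->
  (forall i, (m <= i)%N -> 0 <= r i <= 2 * n i) ->
  unbounded n ->
  exists w : nat -> bool, [/\ periodic_pal w \/ char_sturmian w, abundant w &
    delta_val w (limn_esup (fun i => (n i.+1 / n i)%:E))].
Proof.
move=> mv nS nE rn unb.
have [f_inf|f_fin] := pselect (forall k, exists i, (k < i)%N && f i).
  pose f' i := (m < i)%N && f i.
  have f'_inf k : exists i, (k < i)%N && f' i.
    have [i /andP[lt_i fi]] := f_inf (maxn k m).
    by exists i; rewrite gtn_max in lt_i; rewrite /f' fi andbT.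
  exists (dword f'); split; [right; exact: dword_char_sturmian | exact: dword_abundant|].
  apply: (dword_limsup (m := m) (r := r) (a := a) (C := C)) => // i le_i.
  by have := mv i le_i; rewrite /f' ltnS le_i.
have [k f0] : exists k, forall i, (k < i)%N -> f i = false.
  apply: contrapT => nf; apply: f_fin => k; apply: contrapT => nk; apply: nf.
  by exists k => i lt_i; apply/negP => fi; apply: nk; exists i; rewrite lt_i.
exists (dword xpred0); split; [left; exact: dword_periodic | exact: dword_abundant|].
have sub_m i : (maxn m k <= i)%N -> (m <= i)%N by rewrite geq_max => /andP[].
apply: (dword_limsup (m := maxn m k) (r := r) (a := a) (C := C)) => [i|||i|//].
- rewrite geq_max => /andP[mi ki]; have := mv i mi.
  by rewrite f0.
- by move=> i /sub_m; exact: nS.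
- by move=> i /sub_m; exact: nE.
- by move=> /sub_m; exact: rn.
Qed.

(* The slope with partial quotients 2, 1, 2, 1, ...; the ratio [a / r] runs
   through the cycle (sqrt 3 - 1) / 2, sqrt 3 - 1, sqrt 3. *)
Fixpoint sqrt3_state (i : nat) : R * R :=
  if i is j.+1 then
    let: (r, a) := sqrt3_state j in
    if (i %% 3 != 2)%N then (r + a, r) else (r, r + a)
  else (2, Num.sqrt 3 - 1).

Lemma sqrt3_stateP i : let: (r, a) := sqrt3_state i in
  [/\ 2 <= r, 0 < a &
      match (i %% 3)%N with
      | 0 => 2 * a = (Num.sqrt 3 - 1) * r
      | 1 => a = (Num.sqrt 3 - 1) * r
      | _ => a = Num.sqrt 3 * r
      end].
Proof.
set q := Num.sqrt (3 : R).
have qq : q * q = 3 by rewrite -expr2 sqr_sqrtr.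
have q_gt0 : 0 < q by rewrite sqrtr_gt0.
have [gt_q lt_q] := sqrt3_bounds q_gt0 qq.
elim: i => [|i] /=; first by rewrite -/q; split; lra.
case: (sqrt3_state i) => r a [r_ge a_gt0].
have [[-> ->]|[[-> ->]|[-> ->]]] : (i %% 3 = 0 /\ i.+1 %% 3 = 1 \/
  (i %% 3 = 1 /\ i.+1 %% 3 = 2 \/ i %% 3 = 2 /\ i.+1 %% 3 = 0))%N by lia.
- move=> /= E; split; try lra.
  have E2 : 2 * ((q - 1) * (r + a)) = (q * q - 1) * r + (q - 1) * (2 * a - (q - 1) * r).
    by ring.
  by rewrite E subrr mulr0 qq in E2; lra.
- by move=> /= E; split; lra.
- move=> /= E; split; try lra.
  have -> : (q - 1) * (r + a) = (q * q - 1) * r by rewrite E; ring.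
  by rewrite qq; lra.
Qed.

Lemma sqrt3_realized : exists w : nat -> bool,
  [/\ periodic_pal w \/ char_sturmian w, abundant w &
    delta_val w (Num.sqrt (3 : R))%:E].
Proof.
set q := Num.sqrt (3 : R).
have qq : q * q = 3 by rewrite -expr2 sqr_sqrtr.
have q_gt0 : 0 < q by rewrite sqrtr_gt0.
have [gt_q lt_q] := sqrt3_bounds q_gt0 qq.
pose r i := (sqrt3_state i).1; pose a i := (sqrt3_state i).2.
pose n i := r i + a i.
have mv : gap_moves (fun i => i %% 3 != 2)%N 0 r a.
  move=> i _; rewrite /r /a /=; case: (sqrt3_state i) => x y.
  by case: (_ != _).
have nS i : n i.+1 = n i + r i.
  by have := mv i isT; rewrite /n; case: ifP => _ [-> ->]; ring.
have inv i : [/\ 2 <= r i, 0 < a i & match (i %% 3)%N with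
      | 0 => 2 * a i = (q - 1) * r i
      | 1 => a i = (q - 1) * r i
      | _ => a i = q * r i end].
  by have := sqrt3_stateP i; rewrite /r /a; case: sqrt3_state.
(* The ratio is [1 + r / (r + a)], equal to [q] at residue 0 and at most [q] at the others. *)
have ratio i : n i.+1 / n i <= q /\ ((i %% 3 = 0)%N -> n i.+1 / n i = q).
  have [r_ge a_gt0 E] := inv i.
  have n_gt0 : 0 < n i by rewrite /n; lra.
  have E0 : 2 * a i = (q - 1) * r i -> n i.+1 / n i = q.
    move=> E'; apply: (canLR (mulfK _)); first by rewrite gt_eqF.
    have : 2 * (q * n i - n i.+1) = (q * q - 3) * r i + (q - 1) * (2 * a i - (q - 1) * r i).
      by rewrite nS /n; ring.
    by rewrite qq E' !subrr mulr0 mul0r; lra.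
  split; last by move=> mod_i; rewrite mod_i in E; exact: E0.
  case: (i %% 3)%N E => [/E0 -> //|[|k]] E; rewrite ler_pdivrMr // nS /n E.
    have -> : q * (r i + (q - 1) * r i) = q * q * r i by ring.
    by rewrite qq; nra.
  have -> : q * (r i + q * r i) = (q + q * q) * r i by ring.
  by rewrite qq; nra.
have -> : q%:E = limn_esup (fun i => (n i.+1 / n i)%:E).
  apply/eqP; rewrite eq_le; apply/andP; split.
    apply: limn_esup_ge_frequently => m; exists (m * 3)%N.
    split; first by lia.
    by have [_ ->] := ratio (m * 3)%N; rewrite ?modnMl.
  by apply: (@limn_esup_le_near _ _ _ 0) => i _; have [] := ratio i.
apply: (gap_moves_realized (C := 0) mv) => [i _|i _|i _|].
- exact: nS.
- by rewrite addr0.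
- by have [] := inv i; rewrite /n => *; apply/andP; split; lra.
- apply: (@unbounded_growth R _ 2 0) => // i _.
  by have [] := inv i; rewrite nS; lra.
Qed.

Lemma slow_word_realized (A : Type) (w : nat -> A) (ns : nat -> nat) :
  pal_enum w ns ->
  (limn_esup (fun i => ((ns i.+1)%:R / (ns i)%:R : R)%:E) <
    (Num.sqrt (3 : R))%:E)%E ->
  exists w' : nat -> bool, [/\ periodic_pal w' \/ char_sturmian w', abundant w' &
    delta_val w' (limn_esup (fun i => ((ns i.+1)%:R / (ns i)%:R : R)%:E))].
Proof.
set q := Num.sqrt (3 : R) => enum /limn_esup_lt_near [i0 lt_q].
have qq : q * q = 3 by rewrite -expr2 sqr_sqrtr.
have q_gt0 : 0 < q by rewrite sqrtr_gt0.
have [gt_q lt_q2] := sqrt3_bounds q_gt0 qq.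
have ns_lt i : (ns i < ns i.+1)%N by case: enum.
have ns_ge i : (i <= ns i)%N by elim: i => // i IHi; have := ns_lt i; lia.
have slow i : (maxn i0 1 <= i)%N -> (ns i.+1)%:R <= q * (ns i)%:R.
  rewrite geq_max => /andP[le_i i_gt0]; rewrite -ler_pdivrMr.
    by rewrite ltW // lt_q.
  by rewrite ltr0n; apply: leq_trans (ns_ge i).
have [C [i1 defect]] := jump_defect_constant enum q_gt0 qq slow.
have gapD i : (ns i.+1)%:R = (ns i)%:R + (prefix_gap ns i)%:R :> R.
  by rewrite -natrD /prefix_gap subnKC // ltnW.
(* Setting [a = n + C - r] turns the defect identity at a jump into [r i.+1 = r i + a i] and
   [a i.+1 = r i]. *)
apply: (@gap_moves_realized (fun i => prefix_gap ns i.-1 < prefix_gap ns i)%N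
  (maxn i1 (maxn i0 1)) (fun i => (prefix_gap ns i)%:R)
  (fun i => (ns i)%:R + C%:R - (prefix_gap ns i)%:R) (fun i => (ns i)%:R) (- C%:R)).
- move=> i; rewrite geq_max => /andP[/defect [mono jump] _] /=.
  have D := gapD i; case: ifP => [/jump|] lt_g.
    have : (ns i.+1)%:R + C%:R = (prefix_gap ns i.+1)%:R + (prefix_gap ns i)%:R :> R.
      by rewrite -!natrD lt_g.
    by split; lra.
  have -> : prefix_gap ns i.+1 = prefix_gap ns i by lia.
  by split; lra.
- by move=> i _; exact: gapD.
- by move=> i _; ring.
- move=> i; rewrite geq_max => /andP[_ /slow]; rewrite ler0n /= gapD.
  have : 0 <= (2 - q) * (ns i)%:R by rewrite mulr_ge0 //; lra.
  have : 0 <= (ns i)%:R :> R by [].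
  lra.
- apply: (@unbounded_growth R _ 1 0) => // i _.
  by rewrite natr1 ler_nat.
Qed.

(** Strictly below [sqrt 3] the lengths eventually grow slowly; at [sqrt 3] itself that may fail, so
    an explicit slope is used. *)
Lemma delta_le_sqrt3_realized (A : Type) (w : nat -> A) (d : \bar R) :
  delta_val w d -> (d <= (Num.sqrt (3 : R))%:E)%E ->
  exists w' : nat -> bool,
    [/\ periodic_pal w' \/ char_sturmian w', abundant w' & delta_val w' d].
Proof.
move=> [[_ ->]|[_ [ns [enum ->]]]]; first by rewrite leye_eq.
rewrite le_eqVlt => /predU1P[->|]; first exact: sqrt3_realized.
exact: slow_word_realized enum.
Qed.

End Realization.

Local Open Scope classical_set_scope.

Theorem theorem1p3 (R : realType) :
  DsetPrime R `&` interval_1_sqrt3 R = Dset0 R `&` interval_1_sqrt3 R /\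
  Dset0 R `&` interval_1_sqrt3 R = DsetAll R `&` interval_1_sqrt3 R.
Proof.
have allP A (w : nat -> A) d : delta_val w d -> interval_1_sqrt3 R d ->
    DsetPrime R d /\ Dset0 R d.
  move=> wd [_ le_d]; have [w' [w'P ab w'd]] := delta_le_sqrt3_realized wd le_d.
  by split; exists bool, w'.
split; apply/seteqP; split=> d [[A [w wP]] Id]; split=> //.
- by case: wP => _ wd; have [] := allP _ _ _ wd Id.
- by case: wP => _ wd; have [] := allP _ _ _ wd Id.
- by case: wP => _ wd; exists A, w.
- by have [] := allP _ _ _ wP Id.
Qed.
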